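(* Let $\mathcal{I}=(G,\{r_i,F_i\}_{i\in[N]})$ be any instance of the online matching problem with reusable resources such that for every $i\in[N]$ the usage duration distribution is $F_i=\mathrm{Geometric}(p_i)$ for some $p_i\geq 0$. Let $p=\min_{i\in[N]}p_i$. Then $$\frac{\mathsf{Greedy}(\mathcal{I})}{\mathsf{OPT}(\mathcal{I})}\ \ge\ \frac{1+p}{2}.$$
   Context: Model. An instance $\mathcal{I}=(G,\{r_i,F_i\}_{i\in[N]})$ consists of a bipartite graph $G$ with $N$ offline vertices (''resources'', indexed by $[N]=\{1,\dots,N\}$) and $T$ online vertices (''requests'', indexed by $1,\dots,T$), rewards $0\le r_1\le\dots\le r_N$, and for each resource $i$ a probability distribution $F_i$ of usage durations, supported on $\{1,2,3,\dots\}\cup\{+\infty\}$ ($+\infty$ meaning the resource never returns). Let $N_t\subseteq[N]$ be the set of resources adjacent to request $t$. At each time $t=1,\dots,T$ request $t$ arrives, $N_t$ is revealed, and a policy irrevocably chooses $A_t\in(N_t\cap I_t)\cup\{0\}$, where $I_t\subseteq[N]$ is the set of resources available at time $t$ (all resources are available at time 1) and $0$ means no match. If $A_t=i\in[N]$, the policy earns reward $r_i$, and resource $i$ becomes unavailable for a random duration $D_{it}\ge1$ drawn from $F_i$, independently for every match; it becomes available again at the start of time $t+D_{it}$ and can be matched immediately. $\mathrm{Geometric}(q)$, for $q\in[0,1]$, is the distribution on $\{1,2,\dots\}$ with $\Pr(D=k)=(1-q)^{k-1}q$; for $q=0$ the duration is $+\infty$ almost surely. The greedy policy chooses $A_t=\max\big((N_t\cap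 I_t)\cup\{0\}\big)$, i.e. the available adjacent resource of highest index (hence highest reward). $\mathsf{Greedy}(\mathcal{I})$ is its expected total reward. $\mathsf{OPT}(\mathcal{I})$ is the expected total reward of an optimal clairvoyant policy: a policy of maximum expected total reward among all policies that know the whole instance $\mathcal{I}$ (in particular the entire graph $G$) in advance but do not know the realizations of the usage durations ahead of time (decisions at time $t$ depend only on what has been observed so far). If $\mathsf{OPT}(\mathcal{I})=0$, the ratio inequality is read as the inequality obtained by multiplying through by $\mathsf{OPT}(\mathcal{I})$. *)

(* Defs.v *)
From HB Require Import structures.
From mathcomp Require Import all_boot all_order all_algebra.
From mathcomp Require Import all_classical all_reals all_analysis.

Set Implicit Arguments.
Unset Strict Implicit.
Unset Printing Implicit Defensive.

Import Order.TTheory GRing.Theory Num.Theory.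

Local Open Scope classical_set_scope.
Local Open Scope ring_scope.

(* [Some k] is the duration k and [None] is the duration +oo. *)
Definition duration := option nat.
HB.instance Definition _ := Countable.on duration.
HB.instance Definition _ := Pointed.on duration.
HB.instance Definition _ := @isMeasurable.Build default_measure_display
  duration discrete_measurable discrete_measurable0
  discrete_measurableC discrete_measurableU.

Definition scenario (X : finType) := {ffun X -> duration}.
HB.instance Definition _ (X : finType) := Countable.on (scenario X).
HB.instance Definition _ (X : finType) :=
  isPointed.Build (scenario X) [ffun=> None].
HB.instance Definition _ (X : finType) :=
  @isMeasurable.Build default_measure_display
  (scenario X) discrete_measurable discrete_measurable0
  discrete_measurableC discrete_measurableU.

Section esum_product.
Local Open Scope ereal_scope.
Context {R : realType}.

Lemma esumZl_le (T : choiceType) (A : set T) (f : T -> \bar R) (c : R) :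
  (0 <= c)%R -> (forall t, 0 <= f t) ->
  \esum_(t in A) (c%:E * f t) <= c%:E * \esum_(t in A) f t.
Proof.
move=> c0 f0; apply: ge_ereal_sup => _ [Y [finY YA] <-].
rewrite -ge0_mule_fsumr//; apply: lee_wpmul2l; first by rewrite lee_fin.
by apply: ereal_sup_ubound; exists Y.
Qed.

Lemma esumZl (T : choiceType) (A : set T) (f : T -> \bar R) (c : R) :
  (0 <= c)%R -> (forall t, 0 <= f t) ->
  \esum_(t in A) (c%:E * f t) = c%:E * \esum_(t in A) f t.
Proof.
move=> c0 f0; apply/eqP; rewrite eq_le esumZl_le//=.
have [->|cN0] := eqVneq c 0%R; first by rewrite mul0e esum_ge0// => t _; rewrite mul0e.
have cp : (0 < c)%R by rewrite lt_def cN0.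
rewrite muleC -lee_pdivlMr//.
apply: (@le_trans _ _ (\esum_(t in A) ((c^-1)%:E * (c%:E * f t)))).
  by apply: le_esum => t _; rewrite muleA -EFinM mulVf// mul1e.
rewrite [leRHS]muleC; apply: esumZl_le; first by rewrite invr_ge0.
by move=> t; rewrite mule_ge0// lee_fin.
Qed.


Lemma esum_prod (X : finType) (f : X -> duration -> \bar R)
    (A : X -> set duration) :
  (forall x t, 0 <= f x t) -> (forall x t, f x t \is a fin_num) ->
  (forall x, \esum_(t in A x) f x t \is a fin_num) ->
  \esum_(w in [set w : scenario X | forall x, A x (w x)]) \prod_(x : X) f x (w x)
  = \prod_(x : X) \esum_(t in A x) f x t.
Proof.
move=> f0 ffin Afin.
pose E (s : seq X) := [set w : scenario X |
  (forall x, x \in s -> A x (w x)) /\ (forall x, x \notin s -> w x = None)].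
have key (s : seq X) : uniq s ->
    \esum_(w in E s) \prod_(x <- s) f x (w x)
    = \prod_(x <- s) \esum_(t in A x) f x t.
  elim: s => [_|a s IH /= /andP[as_ us]].
    have -> : E [::] = [set [ffun=> None]].
      apply/seteqP; split=> [w [_ w0]|w ->] /=; last by split=> // x _; rewrite ffunE.
      by apply/ffunP => x; rewrite ffunE w0.
    by rewrite esum_set1 !big_nil.
  rewrite [RHS]big_cons -(IH us).
  pose e (p : duration * scenario X) : scenario X :=
    [ffun x => if x == a then p.1 else p.2 x].
  have esE p x : x \in s -> e p x = p.2 x.
    by move=> xs; rewrite ffunE ifN//; apply: contraNneq as_ => <-.
  rewrite (reindex_esum (A a `*` E s) (E (a :: s)) e); last first.
    split=> [[t w] [/= At [ws wNs]]|[t w] [t' w']|w [ws wNs]].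
    - split=> x; rewrite inE ?ffunE.
        by case: eqVneq => [->//|xa /=]; exact: ws.
      by rewrite negb_or => /andP[/negbTE -> xs]; exact: wNs.
    - rewrite !inE/= => -[_ [_ w0]] [_ [_ w'0]] /ffunP ww'; congr (_, _).
        by have := ww' a; rewrite !ffunE eqxx.
      apply/ffunP => x; have := ww' x; rewrite !ffunE.
      by case: eqVneq => // -> _; rewrite w0// w'0.
    - exists (w a, [ffun x => if x == a then None else w x]) => /=.
        split=> /=; first by apply: ws; rewrite inE eqxx.
        split=> x xs; rewrite ffunE.
          by case: eqVneq as_ => [<-|_ _]; [rewrite xs|apply: ws; rewrite inE xs orbT].
        by case: eqVneq => // xa; apply: wNs; rewrite inE negb_or xa.
      by apply/ffunP => x; rewrite !ffunE/=; case: eqVneq => [->|].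
  transitivity (\esum_(p in A a `*` E s) (f a p.1 * \prod_(x <- s) f x (p.2 x))).
    apply: eq_esum => p _; rewrite big_cons; congr (_ * _).
      by rewrite ffunE eqxx.
    by apply: eq_big_seq => x xs; rewrite esE.
  have P0 (w : scenario X) : 0 <= \prod_(x <- s) f x (w x).
    by apply: prode_ge0 => x _.
  rewrite -(@esum_esum _ _ _ (A a) (fun=> E s)
    (fun t w => f a t * \prod_(x <- s) f x (w x))); last first.
    by move=> t w _ _; rewrite mule_ge0.
  have Pfin : \esum_(w in E s) \prod_(x <- s) f x (w x) \is a fin_num.
    by rewrite IH// big_seq; apply: (big_ind (fun x => x \is a fin_num)) => // *; exact: fin_numM.
  rewrite -[X in _ * X](fineK Pfin) muleC -esumZl//; last first.
    by apply: fine_ge0; apply: esum_ge0.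
  apply: eq_esum => t _; rewrite -[f a t](fineK (ffin _ _)) esumZl//; last exact: fine_ge0.
  by rewrite muleC (fineK Pfin).
transitivity (\esum_(w in E (enum X)) \prod_(x <- enum X) f x (w x)).
  have -> : E (enum X) = [set w : scenario X | forall x, A x (w x)].
    apply/seteqP; split=> [w [w1 _] x|w wA] /=; first by apply: w1; rewrite mem_enum.
    by split=> x; [move=> _; exact: wA|rewrite mem_enum].
  by apply: eq_esum => w _; rewrite big_enum.
by rewrite key ?enum_uniq// big_enum.
Qed.

Lemma duration_esum (F : {measure set duration -> \bar R}) (A : set duration) :
  F A = \esum_(t in A) F [set t].
Proof.
pose J n := [set t : duration | A t /\ pickle t = n].
have trivJ : trivIset setT J.
  by move=> m n _ _ [t [[_ <-] [_ <-]]].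
have AE : A = \bigcup_n J n.
  by apply/seteqP; split=> [t At|t [n _ []//]]; exists (pickle t).
rewrite [in RHS]AE nneseries_sum_bigcup//.
rewrite [in LHS]AE measure_bigcup//.
transitivity (\sum_(0 <= n <oo) F (J n)).
  by congr (limn _); apply/funext => n; apply: eq_bigl => i; rewrite in_setT.
apply: eq_eseriesr => n _.
have [[t Jt]|J0] := pselect (J n !=set0).
  have -> : J n = [set t].
    apply/seteqP; split=> [u [_ un]|_ ->//] /=.
    by apply: (pcan_inj pickleK); rewrite un; case: Jt.
  by rewrite esum_set1.
have -> : J n = set0 by apply/seteqP; split=> // u Ju; apply: J0; exists u.
by rewrite esum_set0 measure0.
Qed.

End esum_product.

Section product_law.
Local Open Scope ereal_scope.
Context {R : realType} {X : finType}.
Variable F : X -> probability duration R.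

(* The law of a family of independent durations, the x-th one having law F x. *)
Definition product_law (A : set (scenario X)) : \bar R :=
  \esum_(w in A) \prod_(x : X) F x [set w x].

Let product_law0 : product_law set0 = 0.
Proof. exact: esum_set0. Qed.

Let product_law_ge0 A : 0 <= product_law A.
Proof. by apply: esum_ge0 => w _; apply: prode_ge0. Qed.

Let product_law_sigma_additive : semi_sigma_additive product_law.
Proof.
move=> G mG tG mUG; rewrite /product_law nneseries_sum_bigcup//; last first.
  by move=> w; apply: prode_ge0.
by apply: is_cvg_nneseries => n _ _; exact: product_law_ge0.
Qed.

HB.instance Definition _ := isMeasure.Build _ _ _ product_law
  product_law0 product_law_ge0 product_law_sigma_additive.

Lemma product_law_rectangle (B : X -> set duration) :
  product_law [set w | forall x, B x (w x)] = \prod_(x : X) F x (B x).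
Proof.
rewrite /product_law (@esum_prod _ _ (fun x t => F x [set t]))//.
- by apply: eq_bigr => x _; rewrite [RHS]duration_esum.
- by move=> x t; exact: fin_num_measure.
- by move=> x; rewrite -duration_esum; exact: fin_num_measure.
Qed.

Let product_law_setT : product_law setT = 1.
Proof.
transitivity (product_law [set w | forall x, [set: duration] (w x)]).
  by congr product_law; apply/seteqP.
rewrite (product_law_rectangle (fun=> setT)) big1// => x _.
exact: probability_setT.
Qed.

HB.instance Definition _ := Measure_isProbability.Build _ _ _ product_law
  product_law_setT.

End product_law.

Definition is_geometric {R : realType} (q : R) (F : probability duration R) :=
  [/\ F [set Some 0%N] = 0%:E,
      forall k : nat, F [set Some k.+1] = ((1 - q) ^+ k * q)%:E &
      F [set None] = (if q == 0 then 1 else 0)%:E].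

(* Resources and requests are numbered from 0 instead of 1.  [nbr t] is the   *)
(* neighbourhood of request t, which determines the bipartite graph.          *)
Record instance (R : realType) := Instance {
  nres : nat;
  nreq : nat;
  nbr : 'I_nreq -> {set 'I_nres};
  rew : 'I_nres -> R;
  law : 'I_nres -> probability duration R;
  rew_ge0 : forall i, 0 <= rew i;
  rew_le : forall i j : 'I_nres, (i <= j)%N -> rew i <= rew j;
  law_ge1 : forall i, law i [set Some 0%N] = 0%:E }.

Section model.
Context {R : realType}.
Variable I : instance R.

Local Notation resource := 'I_(nres I).
Local Notation request := 'I_(nreq I).

(* Entry s of a history is (I_s, A_s): the resources available at time s and  *)
(* the action then taken, [None] meaning no match.  Past usage durations are  *)
(* observed only through these availability sets.                             *)
Definition history := seq ({set resource} * option resource).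

Definition policy := request -> history -> {set resource} -> option resource.

Definition admissible (pi : policy) := forall t h S i,
  pi t h S = Some i -> i \in nbr t :&: S.

Definition returned (s : nat) (d : duration) (t : nat) : bool :=
  if d is Some k then (s + k <= t)%N else false.

(* w (i, s) is the duration of the match of resource i to request s, if that  *)
(* match takes place.                                                         *)
Definition outcome := scenario (resource * request)%type.

Definition available (w : outcome) (h : history) (t : request) :
    {set resource} :=
  [set i | [forall s : request,
    ((s < t)%N && (nth None (unzip2 h) s == Some i)) ==>
    returned s (w (i, s)) t]].

Definition run (pi : policy) (w : outcome) : history :=
  foldl (fun h t => let S := available w h t in rcons h (S, pi t h S))
    [::] (enum 'I_(nreq I)).

Definition total_reward (pi : policy) (w : outcome) : R :=
  \sum_(o <- run pi w) (if o.2 is Some i then rew i else 0).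

Definition duration_law : probability outcome R :=
  product_law (fun x : resource * request => law x.1).

Definition value (pi : policy) : \bar R :=
  ('E_duration_law[total_reward pi])%E.

Definition max_index (A : {set resource}) : option resource :=
  if [pick i in A] is Some i0 then Some [arg max_(i > i0 in A) (i : nat)]
  else None.

Definition greedy : policy := fun t _ S => max_index (nbr t :&: S).

Definition Greedy : \bar R := value greedy.

(* Policies know I, being arbitrary functions chosen for I, but see the       *)
(* outcome w only through the history; randomizing would not change the       *)
(* supremum, as a randomized policy is a mixture of deterministic ones.       *)
Definition OPT : \bar R := ereal_sup [set value pi | pi in admissible].

End model.

(* Main.v *)
(** A geometric duration is memoryless, so the process is driven by the set T
    left over after each decision: between two decisions every resource flips a
    coin of bias p_i, and the heads form a set A that enlarges T to T :|: A.
    Run an arbitrary policy and greedy with common coins.  If they are left with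
    T' and T respectively, then, with b = (1 - p) / (1 + p),

      E[future reward of the policy]
        <= (1 + b) E[future reward of greedy] + b * (total reward of T' :\: T),

    which for T' = T is the theorem, since 1 + b = 2 / (1 + p).  The inequality
    is proved by backward induction.  It holds for each value of the coins
    unless the policy takes a resource a that it kept (a in T') and that greedy
    lacks (a not in T, a not in A).  As a is in T', the policy's choice does not
    depend on the coin of a, so this loss can be averaged with the gain made when
    that coin lets greedy have a; b is exactly what balances the two. *)
Require Import Defs.
From mathcomp Require Import all_boot all_order all_algebra.
From mathcomp Require Import all_classical all_reals all_analysis.
From mathcomp Require Import zify ring lra.

Set Implicit Arguments.
Unset Strict Implicit.
Unset Printing Implicit Defensive.
Import Order.TTheory GRing.Theory Num.Theory.
Local Open Scope ring_scope.

(** * Random sets made of independent coins *)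

(** Pairing [A] with [a |: A] isolates the coin of [a] while all other coins stay fixed. *)
Lemma sum_set_pair (X : finType) (V : nmodType) (a : X) (P : pred {set X})
    (F : {set X} -> V) :
  (forall A, P (a |: A) = P A) ->
  \sum_(A | P A) F A =
  \sum_(A | P A && (a \notin A)) (F A + F (a |: A)).
Proof.
move=> Pa; rewrite big_split/= (bigID (fun A : {set X} => a \in A))/= addrC; congr (_ + _).
rewrite (reindex_onto (fun A => a |: A) (fun A => A :\ a)) /=; last first.
  by move=> A /andP[_ aA]; rewrite finset.setD1K.
apply: eq_bigl => A; rewrite Pa setU11 andbT; congr (_ && _).
apply/eqP/idP => [<-|aA]; first by rewrite setD11.
by rewrite finset.setU1K.
Qed.

Section coins.
Context {R : realType} {X : finType}.
Variable q : X -> R.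
Hypothesis q01 : forall i, 0 <= q i <= 1.

Definition coin_weight (A : {set X}) : R :=
  \prod_i (if i \in A then q i else 1 - q i).

Lemma coin_weight_ge0 A : 0 <= coin_weight A.
Proof.
apply: prodr_ge0 => i _; have /andP[q0 q1] := q01 i.
by case: ifP => // _; rewrite subr_ge0.
Qed.

Lemma coin_weightU1 a (A : {set X}) : a \notin A ->
  exists2 m, 0 <= m & coin_weight A = (1 - q a) * m /\
                      coin_weight (a |: A) = q a * m.
Proof.
move=> /negbTE aA; exists (\prod_(i | i != a) (if i \in A then q i else 1 - q i)).
  apply: prodr_ge0 => i _; have /andP[q0 q1] := q01 i.
  by case: ifP => // _; rewrite subr_ge0.
rewrite /coin_weight; split; rewrite (bigD1 a) //= ?aA// finset.setU11.
congr (_ * _); apply: eq_bigr => i /negbTE ia.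
by rewrite finset.in_setU1 ia.
Qed.

(** The event constrains each coin separately: coins in [T] are free and contribute
    [q i + (1 - q i) = 1], the others must agree with [S]. *)
Lemma coin_weight_union (T S : {set X}) : T \subset S ->
  \sum_(A | T :|: A == S) coin_weight A =
  \prod_(i | i \notin T) (if i \in S then q i else 1 - q i).
Proof.
move=> /fintype.subsetP TS; rewrite big_mkcond [RHS]big_mkcond/=.
(* [F] and [G] are the weights of heads and tails, set to 0 where they contradict [T :|: A = S]; the
   sum over [A] then factors. *)
pose F i := if (i \in T) || (i \in S) then q i else 0.
pose G i := if (i \in T) || (i \notin S) then 1 - q i else 0.
transitivity (\sum_(A : {set X}) \prod_i (if i \in A then F i else G i)).
  apply: eq_bigr => A _; case: eqP => [TAS|TAS].
    apply: eq_bigr => i _; rewrite /F /G -TAS !inE.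
    by case: (i \in T); case: (i \in A).
  have [i iS] : exists i, (i \in T :|: A) != (i \in S).
    apply/existsP; apply: contra_notT TAS; rewrite negb_exists => /forallP H.
    by apply/setP => i; have /negPn/eqP := H i.
  rewrite (bigD1 i)//= /F /G.
  move: iS; rewrite inE; have := TS i; case: (i \in T) => /=.
    by move=> ->.
  by move=> _; case: (i \in A); case: (i \in S); rewrite ?mul0r.
rewrite -bigA_distr; apply: eq_bigr => i _; rewrite /F /G.
by case: (i \in T) => /=; [ring|case: (i \in S) => /=; ring].
Qed.

End coins.

(** * Greedy against an arbitrary policy in the coin-driven process *)

Section dynamic_programming.
Context {R : realType}.
Variable I : instance R.
Variable q : 'I_(nres I) -> R.
Hypothesis q01 : forall i, 0 <= q i <= 1.
Local Notation resource := 'I_(nres I).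
Local Notation request := 'I_(nreq I).

Definition earning (a : option resource) : R := if a is Some i then rew i else 0.

Definition leftover (S : {set resource}) (a : option resource) :=
  if a is Some i then S :\ i else S.

(** Coins are flipped before each decision, so a resource taken at one request may be back at the
    next; coins of resources in [T] change nothing. *)
Fixpoint expected (pi : policy I) (ts : seq request) (h : history I)
    (T : {set resource}) : R :=
  if ts is t :: ts then
    \sum_(A : {set resource}) coin_weight q A *
      (let S := T :|: A in let a := pi t h S in
       earning a + expected pi ts (rcons h (S, a)) (leftover S a))
  else 0.

Definition worth (A : {set resource}) : R := \sum_(i in A) rew i.

Lemma earning_ge0 a : 0 <= earning a.
Proof. by case: a => //= i; exact: rew_ge0. Qed.

Lemma worth_le (A B : {set resource}) : A \subset B -> worth A <= worth B.
Proof.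
move=> /fintype.subsetP AB; rewrite /worth [leRHS](big_setID A) /=.
have -> : (B :&: A)%SET = A by apply/finset.setIidPr/fintype.subsetP.
by rewrite lerDl sumr_ge0// => i _; exact: rew_ge0.
Qed.

Lemma worthD1 (A : {set resource}) a : a \in A -> worth A = rew a + worth (A :\ a).
Proof. by move=> aA; rewrite /worth (big_setD1 a). Qed.

Lemma worthU (A B : {set resource}) a :
  A \subset a |: B -> worth A <= rew a + worth B.
Proof.
move=> AB; apply: (le_trans (worth_le AB)).
have [aB|aB] := boolP (a \in B); last by rewrite /worth big_setU1.
by rewrite (finset.setUidPr _) ?finset.sub1set// lerDr rew_ge0.
Qed.

Lemma max_indexP (A : {set resource}) :
  if max_index A is Some j then j \in A /\ (forall i, i \in A -> (i <= j)%N)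
  else A = finset.set0.
Proof.
rewrite /max_index; case: pickP => [i0 i0A|A0].
  by case: arg_maxnP.
by apply/setP => i; rewrite inE A0.
Qed.

Lemma le_earning_max_index (A : {set resource}) i :
  i \in A -> rew i <= earning (max_index A).
Proof.
move=> iA; have := max_indexP A; case: max_index => [j [_ /(_ _ iA)]|A0] /=.
  exact: rew_le.
by rewrite A0 inE in iA.
Qed.

(** The coins [A] reach both sides alike, so the set greedy lacks can grow only by greedy's choice
    [g], and not even by that if the policy takes [g] too. *)
Lemma worth_leftover (T' T A : {set resource}) (a g : option resource) :
  worth (leftover (T' :|: A) a :\: leftover (T :|: A) g) <=
    (if g == a then 0 else earning g) + worth (leftover (T' :\: T) a).
Proof.
case: g => [g|] /=; last first.
  rewrite if_same add0r; apply/worth_le/fintype.subsetP => i; rewrite !inE negb_or.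
  case: a => [a|]; rewrite !inE.
    by move=> /andP[/andP[-> /negbTE ->]]; rewrite orbF.
  by move=> /andP[/andP[-> /negbTE ->]]; rewrite orbF.
case: eqP => [<-|_].
  rewrite add0r; apply/worth_le/fintype.subsetP => i; rewrite /= !inE.
  by case: (i == g); case: (i \in T); case: (i \in A); rewrite //= orbF.
apply/worthU/fintype.subsetP => i; case: a => [a|]; rewrite /= !inE.
  by case: (i == g); case: (i \in T); case: (i \in A); rewrite //= orbF.
by case: (i == g) => //=; case: (i \in T) => //=; case: (i \in A); rewrite //= orbF.
Qed.

(* For fixed coins A and actions a and g of the policy and of greedy, the one-step
   defect in the inequality that is proved by induction. *)
Definition gap (b : R) (T' T A : {set resource}) (a g : option resource) :=
  earning a + b * worth (leftover (T' :|: A) a :\: leftover (T :|: A) g)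
  - (1 + b) * earning g - b * worth (T' :\: T).

(** Greedy earns at least [earning a], and its choice adds at most [earning g] to the worth it
    lacks; the term [(1 + b) * earning g] pays for both. *)
Lemma gap_available (b : R) (T' T A N : {set resource}) (a : option resource) :
  0 <= b -> (forall i, a = Some i -> i \in N :&: (T :|: A)) ->
  gap b T' T A a (max_index (N :&: (T :|: A))) <= 0.
Proof.
move=> b0 aN; set g := max_index _.
have ag : earning a <= earning g.
  case: a aN => [i|_]; last exact: earning_ge0.
  by move=> /(_ i erefl); exact: le_earning_max_index.
have := worth_leftover T' T A a g.
have : worth (leftover (T' :\: T) a) <= worth (T' :\: T).
  by case: a {aN ag} => //= a; apply/worth_le/subD1set.
have g0 := earning_ge0 g.
rewrite /gap; set w1 := worth (leftover _ _); set w2 := worth (T' :\: T); set w := worth _.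
have : (if g == a then 0 else earning g) <= earning g by case: ifP.
move=> H1 H2 H3.
have : b * w <= b * (earning g + w2) by apply: ler_wpM2l => //; lra.
by rewrite mulrDr; lra.
Qed.

(* The hypothesis on [x], which will be a [p_ i], says [p <= x] when
   [b = (1 - p) / (1 + p)]. *)
Lemma gap_pair (b x : R) (T' T A N : {set resource}) (a : resource) :
  0 <= b <= 1 -> 0 <= x <= 1 -> (1 - x) * (1 - b) <= x * (2 * b) ->
  a \in N -> a \in T' :\: T -> a \notin A ->
  (1 - x) * gap b T' T A (Some a) (max_index (N :&: (T :|: A))) +
  x * gap b T' T (a |: A) (Some a) (max_index (N :&: (T :|: (a |: A)))) <= 0.
Proof.
move=> /andP[b0 b1] /andP[x0 x1] xb aN aT aA.
set g := max_index _; set g' := max_index _.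
have g0 := earning_ge0 g; have g'0 := earning_ge0 g'; have a0 := @rew_ge0 _ I a.
(* If greedy passes over an available [a], its choice is available whatever the coin of [a] shows,
   so it earns at least [rew a] in both cases. *)
have aga : g' != Some a -> rew a <= earning g /\ rew a <= earning g'.
  have : a \in N :&: (T :|: (a |: A)) by rewrite !inE aN eqxx orbT.
  have := max_indexP (N :&: (T :|: (a |: A))); rewrite -/g'.
  case: g' {g'0} => [j [jN jmax] /jmax aj ja|->]; last by rewrite inE.
  have rj : rew a <= rew j by exact: rew_le.
  split=> //; apply: (le_trans rj); apply: le_earning_max_index.
  move: jN; rewrite !inE => /andP[-> /=]; case/or3P => [->//|/eqP je|->].
    by rewrite je eqxx in ja.
  by rewrite orbT.
have := worth_leftover T' T A (Some a) g.
have := worth_leftover T' T (a |: A) (Some a) g'.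
rewrite /gap !(worthD1 aT)/=.
set w := worth ((T' :\: T) :\ a).
set w1 := worth (_ :\: leftover _ g'); set w2 := worth (_ :\: leftover _ g) => H1 H2.
have {}H2 : b * w2 <= b * (earning g + w).
  by apply: ler_wpM2l => //; apply: le_trans H2 _; case: ifP => _; lra.
have {}H1 : b * w1 <= b * ((if g' == Some a then 0 else earning g') + w).
  exact: ler_wpM2l.
(* On tails the policy earns [rew a], but [a] leaves the set greedy lacks, which gives back
   [b * rew a]. *)
have gap0 : rew a + b * w2 - (1 + b) * earning g - b * (rew a + w) <=
    (1 - b) * rew a - earning g by rewrite mulrDr in H2; lra.
have {}gap0 := ler_wpM2l (_ : 0 <= 1 - x) gap0.
apply: le_trans (lerD (gap0 _) (lexx _)) _; first by rewrite subr_ge0.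
(* If greedy also takes [a] on heads, the gap there is at most [- (2 * b) * rew a]; by the
   hypothesis on [x] this outweighs the loss on tails. *)
have [g'a|g'a] := eqVneq g' (Some a).
  rewrite g'a eqxx add0r /= in H1 *.
  have : rew a + b * w1 - (1 + b) * rew a - b * (rew a + w) <= - (2 * b) * rew a.
    by lra.
  move=> /(ler_wpM2l x0) H; apply: le_trans (lerD (lexx _) H) _.
  have : rew a * ((1 - x) * (1 - b)) <= rew a * (x * (2 * b)) by apply: ler_wpM2l.
  have : 0 <= (1 - x) * earning g by rewrite mulr_ge0// subr_ge0.
  by move=> ? ?; lra.
case: (aga g'a) => ag ag'; rewrite (negbTE g'a) in H1.
have h1 : (1 - b) * rew a - earning g <= 0.
  have : 0 <= b * rew a by exact: mulr_ge0.
  by lra.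
have h2 : rew a + b * w1 - (1 + b) * earning g' - b * (rew a + w) <= 0.
  have : 0 <= b * rew a by exact: mulr_ge0.
  by rewrite mulrDr in H1; lra.
have := mulr_ge0_le0 (_ : 0 <= 1 - x) h1.
by move=> /(_ ltac:(by rewrite subr_ge0)); have := mulr_ge0_le0 x0 h2; lra.
Qed.

Lemma sum_gap_le0 (b : R) (a_ : {set resource} -> option resource)
    (N T' T : {set resource}) :
  (forall S i, a_ S = Some i -> i \in N :&: S) -> 0 <= b <= 1 ->
  (forall i, (1 - q i) * (1 - b) <= q i * (2 * b)) ->
  \sum_(A : {set resource}) coin_weight q A *
    gap b T' T A (a_ (T' :|: A)) (max_index (N :&: (T :|: A))) <= 0.
Proof.
move=> a_N b01 qb; have /andP[b0 _] := b01.
rewrite (partition_big (fun A => a_ (T' :|: A)) predT)//=.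
apply: sumr_le0 => -[a|] _; last first.
  apply: sumr_le0 => A /eqP ->; apply: mulr_ge0_le0; first exact: coin_weight_ge0.
  exact: gap_available.
(* Outside [T' :\: T], the resource [a] is available to greedy too, and each gap is nonpositive by
   itself. *)
have [aT|aT] := boolP (a \in T' :\: T); last first.
  apply: sumr_le0 => A /eqP aA; apply: mulr_ge0_le0; first exact: coin_weight_ge0.
  apply: gap_available => // i; rewrite aA => -[<-].
  move: (a_N _ _ aA) aT; rewrite !inE negb_and negbK => /andP[-> /orP[-> /=|->]].
    by rewrite orbF => ->.
  by rewrite orbT.
(* As [a] is in [T'], its coin does not affect [T' :|: A], so [A] and [a |: A] lie in the same class
   of the partition. *)
rewrite (sum_set_pair (a := a)) => [|A]; last first.
  congr (a_ _ == _); apply/setP => i; move: aT; rewrite !inE.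
  by case: eqP => // -> /andP[_ ->].
apply: sumr_le0 => A /andP[/eqP aA aNA].
have aA' : a_ (T' :|: (a |: A)) = Some a.
  rewrite -aA; congr a_; apply/setP => i; move: aT; rewrite !inE.
  by case: eqP => // -> /andP[_ ->].
have aN : a \in N by have := a_N _ _ aA; rewrite inE => /andP[].
have [m m0 [-> ->]] := coin_weightU1 q01 aNA; rewrite aA aA'.
rewrite ![_ * m * _]mulrAC -mulrDl; apply: mulr_le0_ge0 => //.
exact: gap_pair.
Qed.

(** The induction relates only [T'] and [T]: greedy ignores its history, and [sum_gap_le0] holds for
    whatever the policy chooses on [h']. *)
Lemma expected_le (b : R) (pi : policy I) :
  admissible pi -> 0 <= b <= 1 ->
  (forall i, (1 - q i) * (1 - b) <= q i * (2 * b)) ->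
  forall ts h' h T' T,
  expected pi ts h' T' <=
    (1 + b) * expected (@greedy _ I) ts h T + b * worth (T' :\: T).
Proof.
move=> pi_adm b01 qb; have /andP[b0 _] := b01.
elim=> [|t ts IH] h' h T' T /=.
  by rewrite mulr0 add0r mulr_ge0// sumr_ge0// => i _; exact: rew_ge0.
have sum1 : \sum_(A : {set resource}) coin_weight q A = 1.
  rewrite /coin_weight -(@bigA_distr R 0 1 *%R +%R _ q (fun i => 1 - q i)).
  by rewrite big1// => i _ /=; ring.
have := @sum_gap_le0 b (pi t h') (nbr t) T' T (fun S i => pi_adm t h' S i) b01 qb.
(* Spreading the constant term over the coins lets the two processes be compared for each [A]. *)
have -> : b * worth (T' :\: T) =
    \sum_(A : {set resource}) coin_weight q A * (b * worth (T' :\: T)).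
  by rewrite -mulr_suml sum1 mul1r.
rewrite mulr_sumr -big_split/= => gap_le0.
rewrite -subr_le0 -sumrB; apply: le_trans gap_le0; apply: ler_sum => A _.
have := IH (rcons h' (T' :|: A, pi t h' (T' :|: A)))
  (rcons h (T :|: A, greedy t h (T :|: A)))
  (leftover (T' :|: A) (pi t h' (T' :|: A)))
  (leftover (T :|: A) (greedy t h (T :|: A))).
move=> /(ler_wpM2l (coin_weight_ge0 q01 A)).
rewrite /gap /greedy /=; lra.
Qed.

End dynamic_programming.

Local Open Scope classical_set_scope.
Local Open Scope ring_scope.

(** * Tails of geometric durations *)

Lemma returned_leq s d t u : (t <= u)%N -> returned s d t -> returned s d u.
Proof. by case: d => // k tu /leq_trans; exact. Qed.

Section geometric.
Context {R : realType}.
Variables (q : R) (F : probability duration R).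
Hypothesis geo : is_geometric q F.

(** Peeling off the value [m.+1] removes a fraction [q] of the tail; for [m = 0] the tail misses
    only the duration 0, of probability 0. *)
Lemma geometric_tail s m :
  F [set d | ~~ returned s d (s + m)] = ((1 - q) ^+ m)%:E.
Proof.
case: geo => F0 FS _; elim: m => [|m IH].
  have -> : [set d | ~~ returned s d (s + 0)] = ~` [set Some 0%N].
    apply/seteqP; split=> d /=; first by move=> + d0; rewrite d0 /= leqnn.
    by case: d => [[|k]|] //= _; rewrite leq_add2l.
  by rewrite probability_setC// F0 sube0 expr0.
have UE : [set d | ~~ returned s d (s + m)] =
    ([set Some m.+1] : set duration) `|` [set d | ~~ returned s d (s + m.+1)].
  apply/seteqP; split=> [[k|] /=|[k|] /=]; rewrite ?leq_add2l.
  - rewrite -!ltnNge leq_eqVlt => /orP[/eqP <-|mk]; [by left|by right].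
  - by move=> _; right.
  - rewrite -!ltnNge => -[[->//]|]; exact: ltnW.
  - by [].
have : F [set d | ~~ returned s d (s + m)] =
    (F [set Some m.+1] + F [set d | ~~ returned s d (s + m.+1)])%E.
  rewrite UE; apply: measureU => //.
  by apply/seteqP; split=> [d [-> /=]|//]; rewrite leqnn.
rewrite IH (FS m); have := fin_num_measure F [set d | ~~ returned s d (s + m.+1)].
case: (F _) => [r _|/(_ I)//|/(_ I)//].
rewrite -EFinD => -[] H; congr (_%:E); rewrite exprS; lra.
Qed.

End geometric.

(** * From usage durations to coins *)

Section model.
Context {R : realType}.
Variable I : instance R.
Variable q : 'I_(nres I) -> R.
Hypothesis geo : forall i, is_geometric (q i) (law i).
Local Notation resource := 'I_(nres I).
Local Notation request := 'I_(nreq I).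
Implicit Types (h : history I) (S T : {set resource}) (w : outcome I).

Fixpoint gain (pi : policy I) (ts : seq request) h w : R :=
  if ts is t :: ts then
    let S := available w h t in let a := pi t h S in
    earning a + gain pi ts (rcons h (S, a)) w
  else 0.

Lemma gain_ge0 pi ts h w : 0 <= gain pi ts h w.
Proof.
elim: ts h => [|t ts IH] h /=; first exact: lexx.
by apply: addr_ge0; [exact: earning_ge0|exact: IH].
Qed.

Lemma total_rewardE pi w : total_reward pi w = gain pi (enum 'I_(nreq I)) [::] w.
Proof.
suff H ts h : \sum_(o <- foldl (fun h t => let S := available w h t in
    rcons h (S, pi t h S)) h ts) earning o.2 =
    \sum_(o <- h) earning o.2 + gain pi ts h w.
  by rewrite /total_reward /run [LHS]H big_nil add0r.
elim: ts h => [|t ts IH] h /=; first by rewrite addr0.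
by rewrite IH -cats1 big_cat big_seq1/= addrA.
Qed.

Definition played h (s : nat) (i : resource) := nth None (unzip2 h) s == Some i.

Definition rect (B : resource * request -> set duration) : set (outcome I) :=
  [set w | forall x, B x (w x)].

(* [tracks h T B]: the durations compatible with the history [h] form the
   rectangle [rect B], and [T] is the set of resources left by the last decision.
   A resource outside [T] is in use since its last match [s], and all that is known
   of the duration of this match is that it has not elapsed at the last decision;
   this is what makes the memorylessness applicable.  Matches not yet made are only
   known to last at least 1, an event of probability 1. *)
Definition tracks h T (B : resource * request -> set duration) :=
  [/\ forall i (s : request), i \in T -> (s < size h)%N -> played h s i ->
        forall d, B (i, s) d -> returned s d (size h),
      forall i, i \notin T -> exists s : request,
        [/\ (s < size h)%N, played h s i,
            B (i, s) = [set d | ~~ returned s d (size h).-1] &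
            forall s' : request, s' != s -> (s' < size h)%N -> played h s' i ->
              forall d, B (i, s') d -> returned s' d (size h)] &
      forall i (s : request), (size h <= s)%N ->
        B (i, s) = [set d | ~~ returned s d s]].

Lemma played_rcons h S a s i :
  played (rcons h (S, a)) s i =
  if (s < size h)%N then played h s i else (s == size h) && (a == Some i).
Proof.
rewrite /played /unzip2 map_rcons nth_rcons size_map.
by case: ifP => // _; case: (s == size h).
Qed.

Lemma rect_measure (B : resource * request -> set duration) :
  duration_law I (rect B) = (\prod_x law x.1 (B x))%E.
Proof.
exact: (product_law_rectangle (fun x : resource * request => law x.1) B).
Qed.

(** Observing [S] refines only the pending match of each resource outside [T]: it has just elapsed
    or still runs. By memorylessness this costs a factor [q i] or [1 - q i], and the rectangle stays
    a rectangle. *)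
Lemma tracks_step h T B (t : request) S : size h = t -> tracks h T B -> T \subset S ->
  exists B', [/\ rect B `&` [set w | available w h t = S] = rect B',
    duration_law I (rect B') = (duration_law I (rect B) *
      (\prod_(i | i \notin T) (if i \in S then q i else 1 - q i))%:E)%E &
    forall a, (forall i, a = Some i -> i \in S) ->
      tracks (rcons h (S, a)) (leftover S a) B'].
Proof.
move=> ht [B1 B2 B3] /fintype.subsetP TS.
pose P i (s : request) := i \notin T ->
  [/\ (s < size h)%N, played h s i,
      B (i, s) = [set d | ~~ returned s d (size h).-1] &
      forall s' : request, s' != s -> (s' < size h)%N -> played h s' i ->
        forall d, B (i, s') d -> returned s' d (size h)].
(* [l i] is the match that keeps [i] in use; it is arbitrary for [i] in [T]. *)
have [l lP] : {l : resource -> request & forall i, P i (l i)}.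
  apply: (@choice _ _ P) => i.
  have [iT|iT] := boolP (i \in T); first by exists t; rewrite /P iT.
  by have [s sP] := B2 _ iT; exists s.
(* Not elapsed at [t.-1] but elapsed at [t] means a duration of exactly [t - l i]. *)
pose B' x := if (x.1 \notin T) && (x.2 == l x.1) then
    if x.1 \in S then [set Some (t - x.2)%N]
    else [set d | ~~ returned x.2 d t]
  else B x.
have B'l i : i \notin T -> B' (i, l i) =
    if i \in S then [set Some (t - l i)%N] else [set d | ~~ returned (l i) d t].
  by move=> iT; rewrite /B'/= iT eqxx.
have B'B x : B' x `<=` B x.
  case: x => i s; rewrite /B' /=; case: ifP => [/andP[iT /eqP ->]|_ //].
  have [lt _ -> _] := lP _ iT; rewrite ht in lt *.
  case: ifP => _ d /= => [->|]; first by rewrite /=; lia.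
  by apply: contra; apply: returned_leq; lia.
have availE w : rect B w -> forall i,
    (i \in available w h t) = (i \in T) || returned (l i) (w (i, l i)) t.
  move=> Bw i; rewrite inE; have [iT|iT] /= := boolP (i \in T).
    apply/forallP => s; apply/implyP => /andP[st si].
    by rewrite -ht; apply: B1 (Bw _) => //; rewrite ht.
  have [lt pl _ Bl] := lP _ iT; rewrite ht in lt Bl.
  apply/forallP/idP => [/(_ (l i))|lr s]; first by rewrite lt; move: pl; rewrite /played => ->.
  apply/implyP => /andP[st si]; have [->//|sl] := eqVneq s (l i).
  exact: Bl (Bw _).
have B'ret i (s : request) : i \in S -> (s < t)%N -> played h s i ->
    forall d, B' (i, s) d -> returned s d t.
  move=> iS st si d; have [iT|iT] := boolP (i \in T).
    by move=> /B'B; rewrite -ht; apply: B1 => //; rewrite ht.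
  have [lt pl _ Bl] := lP _ iT; rewrite ht in lt Bl.
  have [->|sl] := eqVneq s (l i); last by move=> /B'B; exact: Bl.
  by rewrite B'l// iS => -> /=; rewrite subnKC// ltnW.
exists B'; split.
- apply/seteqP; split=> [w [Bw /= wS] [i s]|w B'w].
    rewrite /B' /=; case: ifP => [/andP[iT /eqP ->]|_]; last exact: Bw.
    have := availE w Bw i; rewrite wS (negbTE iT)/= => ->.
    have [lt _ Bl _] := lP _ iT; have := Bw (i, l i); rewrite Bl /=.
    case: ifP => [|rF _ /=]; last by rewrite rF.
    by case: (w _) => //= k; rewrite ht in lt * => ? ?; congr Some; lia.
  have Bw : rect B w by move=> x; exact/B'B/B'w.
  split=> //=; apply/setP => i; rewrite (availE _ Bw).
  have [iT|iT] /= := boolP (i \in T); first by rewrite TS.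
  have [lt _ _ _] := lP _ iT; rewrite ht in lt.
  have := B'w (i, l i); rewrite B'l//; case: ifP => _ /=; last exact: negbTE.
  by move=> -> /=; lia.
- rewrite !rect_measure.
  (* [c] is the factor by which the probability of each single duration shrinks. *)
  pose c x := if (x.1 \notin T) && (x.2 == l x.1) then
    if x.1 \in S then q x.1 else 1 - q x.1 else 1.
  transitivity (\prod_(x : resource * request) (law x.1 (B x) * (c x)%:E))%E.
    apply: eq_bigr => -[i s] _; rewrite /c /B' /=; case: ifP => [/andP[iT /eqP ->]|_].
      have [lt _ -> _] := lP _ iT; rewrite ht in lt *.
      have -> : t.-1 = (l i + (t.-1 - l i))%N :> nat by lia.
      rewrite (geometric_tail (geo i)).
      have tE : (t - l i = (t.-1 - l i).+1)%N by lia.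
      case: ifP => _; last first.
        have {1}-> : t = (l i + (t.-1 - l i).+1)%N :> nat by lia.
        by rewrite (geometric_tail (geo i)) -EFinM exprSr.
      by case: (geo i) => _ + _; rewrite tE => ->; rewrite EFinM.
    by rewrite mule1.
  rewrite big_split/=; congr (_ * _)%E; rewrite prodEFin; congr (_%:E).
  rewrite -(pair_bigA _ (fun i s => c (i, s)))/= [RHS]big_mkcond/=.
  apply: eq_bigr => i _; rewrite /c /=.
  have [iT|iT] /= := boolP (i \in T); first by rewrite big1_eq.
  by rewrite -big_mkcond big_pred1_eq.
- move=> a aS; split; rewrite ?size_rcons ht.
  + move=> i s iL st; rewrite played_rcons ht => p d Bd.
    have iS : i \in S by case: a {aS p} iL => //= a; rewrite !inE => /andP[].
    apply: (@returned_leq _ _ t) => //; apply: B'ret Bd => //.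
      move: p; case: ltnP => // _ /andP[_ /eqP ai].
      by rewrite ai /= !inE eqxx in iL.
    move: p; case: ltnP => // _ /andP[_ /eqP ai].
    by rewrite ai /= !inE eqxx in iL.
  + move=> i iL; have [ai|ai] := eqVneq a (Some i).
      (* The match made now becomes the pending one; lasting at least 1 has the required form
         because the new history has size [t.+1]. *)
      exists t; split=> //; first by rewrite played_rcons ht ltnn eqxx ai eqxx.
        rewrite /B' /=; case: ifP => [/andP[iT /eqP tl]|_]; last by rewrite B3// ht.
        by have [] := lP _ iT; rewrite ht -tl ltnn.
      move=> s' s't s'lt; rewrite played_rcons ht.
      have {}s'lt : (s' < t)%N by rewrite ltn_neqAle s't.
      rewrite s'lt => ps d /B'ret H; apply: (@returned_leq _ _ t) => //.
      by apply: H => //; exact: aS.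
    have iS : i \notin S.
      case: a ai iL {aS} => //= a ai; rewrite !inE negb_and negbK.
      by case: eqP => // ia; rewrite ia eqxx in ai.
    have iT : i \notin T by apply: contra iS; exact: TS.
    have [lt pl _ Bl] := lP _ iT; rewrite ht in lt Bl.
    exists (l i); split; first exact: ltnW.
    * by rewrite played_rcons ht lt.
    * by rewrite B'l// (negbTE iS).
    * move=> s' s'l s't; rewrite played_rcons ht (negbTE ai) andbF.
      case: ifP => // s'lt ps d /B'B Bd; apply: (@returned_leq _ _ t) => //.
      exact: Bl Bd.
  + move=> i s ts; rewrite /B' /=; case: ifP => [/andP[iT /eqP sl]|_].
      by have [] := lP _ iT; rewrite ht -sl; lia.
    by rewrite B3// ht ltnW.
Qed.

(** Coins are grouped by the available set [S] they produce, which gives the factor found in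
    [tracks_step]. *)
Lemma expected_cons pi t ts h T :
  expected q pi (t :: ts) h T = \sum_(S : {set resource} | T \subset S)
    (\prod_(i | i \notin T) (if i \in S then q i else 1 - q i)) *
    (earning (pi t h S) +
     expected q pi ts (rcons h (S, pi t h S)) (leftover S (pi t h S))).
Proof.
rewrite /= (partition_big (fun A => T :|: A) (fun S : {set resource} => T \subset S)) /=; last first.
  by move=> A _; apply: finset.subsetUl.
apply: eq_bigr => S TS; rewrite -(coin_weight_union q TS) mulr_suml.
by apply: eq_bigr => A /eqP ->.
Qed.

(** The set available at the next request cuts [rect B] into smaller rectangles, to which the
    induction applies. The [iota] condition makes positions in the history agree with request
    numbers. *)
Lemma integral_gain pi : admissible pi -> forall ts h T B,
  map val ts = iota (size h) (size ts) -> tracks h T B ->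
  (\int[duration_law I]_(w in rect B) (gain pi ts h w)%:E =
   duration_law I (rect B) * (expected q pi ts h T)%:E)%E.
Proof.
move=> pi_adm; elim=> [|t ts IH] h T B.
  by move=> _ _; rewrite /= mule0 integral0.
move=> iotaE hB.
have [ht tsE] : val t = size h /\ map val ts = iota (size h).+1 (size ts).
  by case: iotaE.
have gain0 w : (0 <= (gain pi (t :: ts) h w)%:E)%E by rewrite lee_fin gain_ge0.
pose D S := rect B `&` [set w | available w h t = S].
have -> : rect B = \big[setU/set0]_(S <- index_enum {set resource}) D S.
  rewrite -bigcup_seq; apply/seteqP; split=> [w Bw|w [S _ []//]].
  by exists (available w h t) => //=; exact: mem_index_enum.
rewrite ge0_integral_bigsetU//; last 2 first.
- exact: index_enum_uniq.
- by move=> S S' _ _ [w [[_ /= <-] [_ /= <-]]].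
have -> : \big[setU/set0]_(S <- index_enum {set resource}) D S = rect B.
  rewrite -bigcup_seq; apply/seteqP; split=> [w [S _ []//]|w Bw].
  by exists (available w h t) => //=; exact: mem_index_enum.
have Bfin : duration_law I (rect B) \is a fin_num by exact: fin_num_measure.
rewrite -(fineK Bfin) expected_cons -EFinM mulr_sumr -sumEFin [RHS]big_mkcond.
apply: eq_bigr => S _; case: ifPn => TS; last first.
  suff -> : D S = set0 by rewrite integral_set0.
  apply/seteqP; split=> // w [Bw /= wS]; case/negP: TS; apply/fintype.subsetP => i iT.
  rewrite -wS inE; apply/forallP => s; apply/implyP => /andP[st si].
  by rewrite ht; case: hB => + _ _; apply; [exact: iT|rewrite -ht|exact: si|exact: Bw].
have [B' [DE B'law B'tracks]] := tracks_step (esym ht) hB TS.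
rewrite /D; set a := pi t h S.
have aS i : a = Some i -> i \in S by move=> /pi_adm; rewrite inE => /andP[].
transitivity (\int[duration_law I]_(w in rect B')
    ((earning a)%:E + (gain pi ts (rcons h (S, a)) w)%:E))%E.
  rewrite DE; apply: eq_integral => w; rewrite -DE inE => -[_ /= wS].
  by rewrite wS EFinD.
rewrite ge0_integralD//; last 2 first.
- by move=> w _; rewrite lee_fin earning_ge0.
- by move=> w _; rewrite lee_fin gain_ge0.
rewrite integral_cst// (IH (rcons h (S, a)) (leftover S a)); last 2 first.
- by rewrite size_rcons.
- exact: B'tracks.
transitivity (duration_law I (rect B') * (earning a +
    expected q pi ts (rcons h (S, a)) (leftover S a))%:E)%E.
  by rewrite EFinD muleDr ?fin_num_adde_defl ?fin_num_measure// muleC.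
by rewrite B'law -(fineK Bfin) -!EFinM mulrA.
Qed.

(** Initially nothing is in use, and the starting rectangle excludes only durations 0, a null event,
    so the integral may be restricted to it. *)
Lemma value_expected pi : admissible pi ->
  value pi = (expected q pi (enum 'I_(nreq I)) [::] finset.setT)%:E.
Proof.
move=> pi_adm; pose B (x : resource * request) := [set d | ~~ returned x.2 d x.2].
have B1 : duration_law I (rect B) = 1%E.
  rewrite rect_measure big1// => -[i s] _; rewrite /B /=.
  by have := geometric_tail (geo i) s 0; rewrite addn0 expr0.
have N0 : duration_law I (~` rect B) = 0%E by rewrite probability_setC// B1 subee.
rewrite /value unlock (ge0_negligible_integral (N := ~` rect B))//; last first.
  by move=> w _; rewrite lee_fin total_rewardE gain_ge0.
rewrite setTD setCK; under eq_integral do rewrite total_rewardE.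
rewrite (integral_gain pi_adm (T := finset.setT)) ?B1 ?mul1e//.
- by rewrite val_enum_ord size_enum_ord.
- by split=> [i s|i|i s _] //; rewrite inE.
Qed.

End model.

(** * The ratio bound for greedy *)

Lemma greedy_admissible (R : realType) (I : instance R) : admissible (@greedy R I).
Proof.
move=> t h S i; rewrite /greedy => E.
by have := max_indexP (nbr t :&: S); rewrite E => -[].
Qed.

Theorem theorem2 (R : realType) (I : instance R) (p_ : 'I_(nres I) -> R)
    (p_01 : forall i, 0 <= p_ i <= 1)
    (geo : forall i, is_geometric (p_ i) (law i))
    (p : R) (p_min : (forall i, p <= p_ i) /\ (exists i, p = p_ i)) :
  (OPT I != 0%E -> (((1 + p) / 2)%:E <= Greedy I / OPT I)%E) /\
  (((1 + p) / 2)%:E * OPT I <= Greedy I)%E.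
Proof.
case: p_min => p_le [i0 pi0].
have /andP[p0 p1] : 0 <= p <= 1 by rewrite pi0.
pose b := (1 - p) / (1 + p).
have p1_gt0 : 0 < 1 + p by lra.
have bE : b * (1 + p) = 1 - p by rewrite /b divfK// gt_eqF.
have b01 : 0 <= b <= 1.
  by rewrite divr_ge0 ?subr_ge0 ?(ltW p1_gt0)//= ler_pdivrMr// mul1r; lra.
have qb i : (1 - p_ i) * (1 - b) <= p_ i * (2 * b).
  have := p_le i => pi; have /andP[_ pi1] := p_01 i.
  (* Multiplied by [1 + p], the claim reads [(1 - p_ i) * (2 * p) <= p_ i * (2 * (1 - p))], that is,
     [p <= p_ i]. *)
  rewrite -(ler_pM2r p1_gt0).
  have -> : (1 - p_ i) * (1 - b) * (1 + p) = (1 - p_ i) * ((1 + p) - b * (1 + p)) by ring.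
  have -> : p_ i * (2 * b) * (1 + p) = p_ i * (2 * (b * (1 + p))) by ring.
  rewrite bE; nra.
set V := expected p_ (@greedy R I) (enum 'I_(nreq I)) [::] finset.setT.
have GE : Greedy I = V%:E by apply: value_expected => //; exact: greedy_admissible.
have OPT_le : (OPT I <= ((1 + b) * V)%:E)%E.
  apply: ge_ereal_sup => _ [pi pi_adm <-]; rewrite (value_expected geo pi_adm) lee_fin.
  have := expected_le p_01 pi_adm b01 qb (enum 'I_(nreq I)) [::] [::] finset.setT finset.setT.
  by rewrite finset.setDv /worth big_set0 mulr0 addr0.
(* With [OPT_le] this makes [OPT I] finite, and with [V0] nonnegative, as the division requires. *)
have OPT_ge : (V%:E <= OPT I)%E.
  by rewrite -GE; apply: ereal_sup_ubound; exists (@greedy R I) => //; exact: greedy_admissible.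
have V0 : 0 <= V.
  rewrite -lee_fin -GE; apply: expectation_ge0 => w.
  by rewrite total_rewardE gain_ge0.
rewrite GE; case: (OPT I) OPT_le OPT_ge => [x | |] //; rewrite !lee_fin => x_le x_ge.
have key : (1 + p) / 2 * x <= V.
  have : (1 + p) / 2 * x <= (1 + p) / 2 * ((1 + b) * V) by rewrite ler_pM2l//; lra.
  have -> : (1 + p) / 2 * ((1 + b) * V) = (1 + p + b * (1 + p)) / 2 * V by field.
  by rewrite bE; lra.
split; last exact: key.
rewrite eqe => x0; rewrite inver (negbTE x0) -EFinM lee_fin.
by rewrite ler_pdivlMr// lt_def x0 (le_trans V0).
Qed.
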